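(* Let $c>0$, $\pi\in(0,1)$, let $\varepsilon_0(n)>0$ and $k=k(n)\in\{0,\dots,n-1\}$ satisfy $k/n\to\pi$ and $e^{\varepsilon_0(n)}/n\to c^2$. Put $\delta_n:=1/(1+e^{\varepsilon_0(n)})$. Let $P_n$ be the law of $A-B$ with $A\sim\mathrm{Bin}(n-k,\delta_n)$ and $B\sim\mathrm{Bin}(k,\delta_n)$ independent, and $Q_n$ the law of $1+A'-B'$ with $A'\sim\mathrm{Bin}(n-k-1,\delta_n)$ and $B'\sim\mathrm{Bin}(k+1,\delta_n)$ independent. Let $D=X-Y$ with $X\sim\mathrm{Poi}((1-\pi)/c^2)$ and $Y\sim\mathrm{Poi}(\pi/c^2)$ independent, and $(P_\infty,Q_\infty):=(\mathcal L(D),\mathcal L(1+D))$. Then for every fixed $\varepsilon\ge0$, $$\delta_{Q_n\|P_n}(\varepsilon)\to\delta_{Q_\infty\|P_\infty}(\varepsilon).$$ Under the canonical calibration $e^{\varepsilon_0(n)}=c^2n$ and $k=\lfloor\pi n\rfloor$, the convergence is quantitative: $$\bigl|\delta_{Q_n\|P_n}(\varepsilon)-\delta_{Q_\infty\|P_\infty}(\varepsilon)\bigr|\le(1+e^{\varepsilon})\,\frac{2c^2+3}{c^4n}.$$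
   Context: For probability measures $P,Q$ on a common measurable space and $\varepsilon\ge0$, $\delta_{Q\|P}(\varepsilon):=\sup_A\{Q(A)-e^{\varepsilon}P(A)\}$, the supremum over measurable sets $A$. (It is distinct from the flip probability $\delta_n$.) *)

(* Defs.v *)
From HB Require Import structures.
From mathcomp Require Import all_boot all_order all_algebra.
From mathcomp Require Import all_classical all_reals all_analysis.

Set Implicit Arguments.
Unset Strict Implicit.
Unset Printing Implicit Defensive.

Import Order.TTheory GRing.Theory Num.Theory.
Import numFieldNormedType.Exports.

Local Open Scope classical_set_scope.
Local Open Scope ring_scope.

(* The integers carry the sigma-algebra of all subsets, like [nat]. *)
HB.instance Definition _ := isPointed.Build int 0.
HB.instance Definition _ := @isMeasurable.Build default_measure_display
  int discrete_measurable discrete_measurable0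
  discrete_measurableC discrete_measurableU.

(* delta_{Q||P}(eps), the hockey-stick divergence.  The supremum is a genuine one, see
   [has_sup_hs_divergence]. *)
Definition hs_divergence d (T : measurableType d) (R : realType)
    (Q P : probability T R) (eps : R) : R :=
  sup [set fine (Q A) - expR eps * fine (P A) | A in measurable].

Lemma has_sup_hs_divergence d (T : measurableType d) (R : realType)
    (Q P : probability T R) (eps : R) :
  has_sup [set fine (Q A) - expR eps * fine (P A) | A in measurable].
Proof.
split; first by exists (fine (Q set0) - expR eps * fine (P set0)), set0.
exists 1 => _ [A mA <-].
rewrite lerBlDr (@le_trans _ _ 1)//.
  by rewrite -lee_fin fineK ?probability_le1 ?fin_num_measure.
by rewrite lerDl mulr_ge0 ?expR_ge0 ?fine_ge0.
Qed.

Definition diffz (u : nat * nat) : int := u.1%:Z - u.2%:Z.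

Lemma measurable_diffz : measurable_fun setT diffz.
Proof.
move=> _ Y _; rewrite setTI.
have -> : diffz @^-1` Y =
    \bigcup_(i in [set: nat]) \bigcup_(j in [set j | Y (diffz (i, j))])
      ([set i] `*` [set j]).
  apply/seteqP; split => [[i j] /= Yij|[i j] /= [i' _ [j' Yij [/= -> ->]]]] //.
  by exists i => //; exists j.
apply: bigcup_measurable => i _; apply: bigcup_measurable => j _.
exact: measurableX.
Qed.

HB.instance Definition _ := isMeasurableFun.Build _ _ _ _ diffz measurable_diffz.

Definition succz (z : int) : int := 1 + z.

Lemma measurable_succz : measurable_fun setT succz.
Proof. by []. Qed.

HB.instance Definition _ := isMeasurableFun.Build _ _ _ _ succz measurable_succz.

(* The law of X - Y, for X ~ mu and Y ~ nu independent. *)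
Definition diff_law (R : realType) (mu nu : probability nat R) :
    probability int R :=
  distribution (mu \x nu)%E diffz.

(* The law of 1 + Z, for Z ~ mu. *)
Definition succ_law (R : realType) (mu : probability int R) :
    probability int R :=
  distribution mu succz.

Definition flip_prob (R : realType) (eps0 : R) : R := 1 / (1 + expR eps0).

Definition P_fin (R : realType) (n k : nat) (eps0 : R) : probability int R :=
  diff_law (binomial_prob (n - k) (flip_prob eps0))
           (binomial_prob k (flip_prob eps0)).

Definition Q_fin (R : realType) (n k : nat) (eps0 : R) : probability int R :=
  succ_law (diff_law (binomial_prob (n - k - 1) (flip_prob eps0))
                     (binomial_prob (k + 1) (flip_prob eps0))).

(* The last argument of [poisson_prob] is a dummy: its value does not depend on
   it. *)
Definition P_lim (R : realType) (c p : R) : probability int R :=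
  diff_law (poisson_prob ((1 - p) / c ^+ 2) 0) (poisson_prob (p / c ^+ 2) 0).

Definition Q_lim (R : realType) (c p : R) : probability int R :=
  succ_law (P_lim c p).

(* Main.v *)
(* Le Cam's argument.  Up to an additive error d^2 in every event, one Bernoulli(d)
   variable is a Poisson(d) variable, so m of them (convolution contracts the
   total variation distance) are a Poisson(m d) variable up to m d^2, and changing
   the rate r of a Poisson law into s costs at most |r - s|.  Replacing the two
   independent summands one at a time bounds the total variation distance between
   the finite and the limit laws, and the hockey-stick divergence of (Q, P) is
   1-Lipschitz in Q and e^eps-Lipschitz in P. *)
Require Import Defs.
From HB Require Import structures.
From mathcomp Require Import all_boot all_order all_algebra.
From mathcomp Require Import all_classical all_reals all_analysis.
From mathcomp Require Import measurable_realfun.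
From mathcomp Require Import ring lra.

Set Implicit Arguments.
Unset Strict Implicit.
Unset Printing Implicit Defensive.

Import Order.TTheory GRing.Theory Num.Theory.
Import numFieldNormedType.Exports.

Local Open Scope classical_set_scope.
Local Open Scope ring_scope.

(** * Comparison of mass sequences, convolution, and Le Cam's bound at the level of masses *)

Section Sequences.
Context {R : realType}.
Implicit Types (u v w g : nat -> R) (d e r s : R) (m n N : nat).

(* For probability masses this one-sided bound implies the two-sided one, by
   complementation. *)
Definition dominated_upto e u v := forall g N, (forall i, 0 <= g i <= 1) ->
  \sum_(i < N) g i * u i <= \sum_(i < N) g i * v i + e.

Definition conv u v n := \sum_(i < n.+1) u i * v (n - i)%N.

(* Unlike [poisson_pmf], which is the constant [1] for [r <= 0], this is the right
   mass function for [r = 0] too. *)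
Definition poisson_mass r i : R := r ^+ i / i`!%:R * expR (- r).

Lemma dominated_upto_trans e1 e2 u v w :
  dominated_upto e1 u v -> dominated_upto e2 v w -> dominated_upto (e1 + e2) u w.
Proof.
move=> uv vw g N g01; apply: le_trans (uv g N g01) _.
by rewrite [e1 + e2]addrC addrA lerD2r vw.
Qed.

(** All the excess of [u] over [v] sits at the single index [j], where the weight [g j] is at most
    1. *)
Lemma dominated_upto_at e j u v : 0 <= e ->
  (forall i, u i <= v i + (i == j)%:R * e) -> dominated_upto e u v.
Proof.
move=> e0 uv g N g01.
apply: (@le_trans _ _ (\sum_(i < N) (g i * v i + (i == j :> nat)%:R * e))).
  apply: ler_sum => i _; have /andP[g0 g1] := g01 i.
  apply: le_trans (ler_wpM2l g0 (uv i)) _.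
  by rewrite mulrDr lerD2l ler_piMl// mulr_ge0.
rewrite big_split/= lerD2l -mulr_suml ler_piMl//.
have [jN|Nj] := ltnP j N.
  rewrite (bigD1 (Ordinal jN))//= eqxx big1 ?addr0// => i.
  by rewrite -val_eqE/= => /negbTE ->.
rewrite big1// => i _; suff /negbTE-> : i != j :> nat by [].
by rewrite neq_ltn (leq_trans (ltn_ord i)).
Qed.

Lemma convC u v : conv u v = conv v u.
Proof.
apply/funext => n; rewrite /conv (reindex_inj rev_ord_inj)/=.
by apply: eq_bigr => i _; rewrite subSS subKn 1?[RHS]mulrC// -ltnS ltn_ord.
Qed.

(** The pairs with [i + j < N] are counted by antidiagonals on the left and by rows on the right. *)
Lemma sum_triangle (F : nat -> nat -> R) N :
  \sum_(n < N) \sum_(i < n.+1) F i (n - i)%N =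
  \sum_(i < N) \sum_(j < N - i) F i j.
Proof.
elim: N => [|N IH]; first by rewrite !big_ord0.
rewrite big_ord_recr/= {}IH [X in X + _](_ : _ =
    \sum_(i < N.+1) \sum_(j < N - i) F i j).
  rewrite -big_split/=; apply: eq_bigr => i _.
  by rewrite subSn ?big_ord_recr// -ltnS.
by rewrite big_ord_recr/= subnn big_ord0 addr0.
Qed.

(** Testing [conv u z] against [g] averages, with weights [u i], the tests of [z] against the shifts
    [g (i + _)]. These shifts are again [0,1]-valued, and the weights have mass at most 1, so the
    error stays below [e]. *)
Lemma dominated_upto_conv e u v w : 0 <= e -> (forall i, 0 <= u i) ->
    (forall N, \sum_(i < N) u i <= 1) ->
  dominated_upto e v w -> dominated_upto e (conv u v) (conv u w).
Proof.
move=> e0 u0 u1 vw g N g01.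
have E z : \sum_(n < N) g n * conv u z n =
    \sum_(i < N) u i * \sum_(j < N - i) g (i + j)%N * z j.
  under [RHS]eq_bigr do rewrite mulr_sumr.
  rewrite -(sum_triangle (fun i j => u i * (g (i + j)%N * z j))).
  apply: eq_bigr => n _; rewrite mulr_sumr; apply: eq_bigr => i _.
  by rewrite subnKC 1?mulrCA// -ltnS ltn_ord.
rewrite !{}E; apply: le_trans (_ : _ <= \sum_(i < N)
    u i * (\sum_(j < N - i) g (i + j)%N * w j + e)) _.
  apply: ler_sum => i _; apply: ler_wpM2l => //.
  exact: (vw (fun j => g (i + j)%N)).
under eq_bigr do rewrite mulrDr.
by rewrite big_split/= lerD2l -mulr_suml ler_piMl ?u1.
Qed.

Lemma poisson_mass_ge0 r i : 0 <= r -> 0 <= poisson_mass r i.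
Proof. by move=> r0; rewrite !mulr_ge0 ?exprn_ge0 ?expR_ge0. Qed.

Lemma sum_poisson_mass r N : 0 <= r -> \sum_(i < N) poisson_mass r i <= 1.
Proof.
move=> r0; rewrite -mulr_suml -[leRHS](expRxMexpNx_1 r) ler_wpM2r ?expR_ge0//.
rewrite expRE; apply: le_trans (nondecreasing_cvgn_le _ _ N); last 2 first.
- apply/nondecreasing_seqP => n; rewrite /pseries /series/= big_nat_recr//=.
  by rewrite lerDl mulr_ge0 ?exprn_ge0.
- rewrite (_ : pseries _ _ = series (exp_coeff r)).
    exact: is_cvg_series_exp_coeff.
  by rewrite /pseries exp_coeffE.
rewrite /pseries /series/= big_mkord ler_sum// => i _.
by rewrite [leLHS]mulrC.
Qed.

(** After the exponentials are factored out, this is the binomial theorem for [(r + s) ^+ n]. *)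
Lemma conv_poisson r s :
  conv (poisson_mass r) (poisson_mass s) = poisson_mass (r + s).
Proof.
apply/funext => n; rewrite /conv /poisson_mass opprD expRD addrC exprDn.
rewrite !mulr_suml; apply: eq_bigr => i _; have ni : (i <= n)%N by rewrite -ltnS.
have fact_neq0 k : k`!%:R != 0 :> R by rewrite pnatr_eq0 -lt0n fact_gt0.
rewrite -(bin_fact ni) !natrM -[_ *+ _]mulr_natr.
have := fact_neq0 i; have := fact_neq0 (n - i)%N.
have bin_neq0 : 'C(n, i)%:R != 0 :> R by rewrite pnatr_eq0 -lt0n bin_gt0.
by move=> ? ?; field; apply/and3P.
Qed.

(** Only the outcomes 0 and 1 of the single trial contribute, and Pascal's rule adds them up. *)
Lemma conv_binomial m d :
  conv (binomial_pmf 1 d) (binomial_pmf m d) = binomial_pmf m.+1 d.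
Proof.
apply/funext => -[|n]; rewrite /conv /binomial_pmf.
  by rewrite big_ord1 !bin0 !subn0 !expr0 [in RHS]exprS; ring.
rewrite 2!big_ord_recl big1 ?addr0/=; last first.
  by move=> i _; rewrite (@bin_small 1)// mulr0n mul0r.
rewrite (_ : bump 0 0 = 1%N)// !subSS !subn0 bin0 bin1 !mulr1n.
rewrite !expr0 !expr1 mul1r mulr1 binS mulrnDr !mulrnAr; congr (_ + _).
  (* The extra factor [1 - d] raises the exponent [m - n.+1] to [m - n] only if [n < m]; otherwise
     the truncated subtraction breaks this, but the binomial coefficient vanishes. *)
  have [nm|mn] := ltnP n m; last by rewrite bin_small.
  by rewrite mulrCA -exprS -subSn// subSS.
by rewrite mulrA -exprS.
Qed.

(** By [1 - d <= expR (- d)], there is no excess at 0, and the excess at 1 is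
    [d - d * expR (- d) <= d ^+ 2]. Beyond 1 the Bernoulli mass is zero. *)
Lemma bernoulli_dominated_upto_poisson d : 0 <= d <= 1 ->
  dominated_upto (d ^+ 2) (binomial_pmf 1 d) (poisson_mass d).
Proof.
move=> /andP[d0 d1]; have e1 := expR_ge1Dx (- d).
apply: (@dominated_upto_at _ 1%N); first exact: sqr_ge0.
case=> [|[|i]]; rewrite /binomial_pmf /poisson_mass.
- rewrite !expr0 bin0 fact0 subn0 expr1 invr1 /= /unstable.onem; lra.
- rewrite subnn !expr1 expr0 bin1 divr1 /=; nra.
- by rewrite bin_small// mulr0n/= mul0r addr0 poisson_mass_ge0.
Qed.

Lemma poisson_mass0 i : poisson_mass 0 i = (i == 0%N)%:R.
Proof.
rewrite /poisson_mass oppr0 expR0 mulr1 expr0n.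
by case: i => [|i]; rewrite ?mul0r// fact0 divr1.
Qed.

Lemma binomial_dominated_upto_poisson m d : 0 <= d <= 1 ->
  dominated_upto (m%:R * d ^+ 2) (binomial_pmf m d) (poisson_mass (m%:R * d)).
Proof.
move=> d01; elim: m => [|m IH].
  apply: (@dominated_upto_at _ 0%N) => [|i]; first by rewrite mul0r.
  rewrite !mul0r mulr0 addr0 poisson_mass0 /binomial_pmf.
  case: i => [|i]; last by rewrite bin_small.
  by rewrite bin0 !expr0 mulr1.
have /andP[d0 d1] := d01.
rewrite -conv_binomial -natr1 2!mulrDl 2!mul1r.
(* First the [m] other trials become Poisson with the Bernoulli factor fixed, then the Bernoulli
   factor does with the Poisson one fixed. *)
apply: dominated_upto_trans (_ : dominated_upto _
    (conv (binomial_pmf 1 d) (poisson_mass (m%:R * d))) _).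
  apply: dominated_upto_conv IH; first by rewrite mulr_ge0 ?sqr_ge0.
    by move=> i; exact: binomial_pmf_ge0.
  (* Padding to [N.+2] terms makes both indices 0 and 1 appear, whatever [N] is. *)
  move=> N; apply: le_trans (_ : _ <= \sum_(i < N.+2) binomial_pmf 1 d i) _.
    rewrite 2!big_ord_recr/= -addrA lerDl.
    by rewrite addr_ge0// binomial_pmf_ge0.
  rewrite 2!big_ord_recl big1 => [|i _]; last by rewrite /binomial_pmf bin_small.
  by rewrite /binomial_pmf /= /bump/= !bin0 bin1 /unstable.onem !expr0 !expr1; lra.
rewrite convC -conv_poisson.
apply: dominated_upto_conv.
- exact: sqr_ge0.
- by move=> i; rewrite poisson_mass_ge0// mulr_ge0.
- by move=> N; rewrite sum_poisson_mass// mulr_ge0.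
- exact: bernoulli_dominated_upto_poisson.
Qed.

(** The larger rate is [a + h] with [a] the smaller one. Cancelling the common factor of rate [a]
    leaves rate [h] against rate 0, the point mass at 0, and these differ by
    [1 - expR (- h) <= h]. *)
Lemma poisson_dominated_upto r s : 0 <= r -> 0 <= s ->
  dominated_upto `|r - s| (poisson_mass r) (poisson_mass s).
Proof.
move=> r0 s0.
suff [up dn] : (forall a h, 0 <= a -> 0 <= h ->
    dominated_upto h (poisson_mass a) (poisson_mass (a + h))) /\
  (forall a h, 0 <= a -> 0 <= h ->
    dominated_upto h (poisson_mass (a + h)) (poisson_mass a)).
  have [rs|sr] := lerP r s.
    by rewrite -{2}(subrKC r s); apply: up => //; rewrite subr_ge0.
  by rewrite -{2}(subrKC s r); apply: dn => //; rewrite subr_ge0 ltW.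
have conv0 a : conv (poisson_mass a) (poisson_mass 0) = poisson_mass a.
  by rewrite conv_poisson addr0.
split=> a h a0 h0; rewrite -conv_poisson; [rewrite -{1}[poisson_mass a]conv0|
    rewrite -{2}[poisson_mass a]conv0]; apply: dominated_upto_conv => //;
  try by [move=> i; exact: poisson_mass_ge0|move=> N; exact: sum_poisson_mass].
- apply: (@dominated_upto_at _ 0%N) => // -[|i]; rewrite poisson_mass0/=.
    rewrite /poisson_mass expr0 fact0 divr1 !mul1r -lerBlDl.
    by have := expR_ge1Dx (- h); lra.
  by rewrite mul0r addr0 poisson_mass_ge0.
(* Here the excess is spread over all positive indices; it is bounded by their total mass, at most
   [1 - expR (- h)]. *)
- move=> g [|N] g01; first by rewrite !big_ord0 add0r.
  have := sum_poisson_mass N.+1 h0; have := expR_ge1Dx (- h).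
  rewrite !big_ord_recl !poisson_mass0 /= mulr1.
  rewrite [X in g 0%N + X]big1 => [|i _]; last by rewrite poisson_mass0 mulr0.
  have : \sum_(i < N) g (bump 0 i) * poisson_mass h (bump 0 i) <=
         \sum_(i < N) poisson_mass h (bump 0 i).
    apply: ler_sum => i _; have /andP[_ g1] := g01 (bump 0 i).
    by rewrite ler_piMl// poisson_mass_ge0.
  have -> : poisson_mass h 0 = expR (- h).
    by rewrite /poisson_mass expr0 fact0 divr1 mul1r.
  have /andP[g0 g1] := g01 0%N; have : expR (- h) <= 1 by rewrite expR_le1; lra.
  have := expR_ge0 (- h); set A := \sum_(i < N) _; set B := \sum_(i < N) _.
  by nra.
Qed.

End Sequences.

(** * From mass sequences to probability measures and their products *)

Lemma binomial_le_poisson (R : realType) m (d a : R) (U : set nat) :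
    0 <= d <= 1 -> 0 < a ->
  (binomial_prob m d U <=
   poisson_prob a 0 U + (m%:R * d ^+ 2 + `|m%:R * d - a|)%:E)%E.
Proof.
move=> d01 a0; have /andP[d0 d1] := d01.
have md0 : 0 <= m%:R * d by rewrite mulr_ge0.
have := dominated_upto_trans (binomial_dominated_upto_poisson m d01)
  (poisson_dominated_upto md0 (ltW a0)).
(* Truncation at [m.+1] keeps the whole binomial support, and the omitted Poisson terms only enlarge
   the right-hand side. The intermediate rate [m%:R * d] may be 0, so it is handled through
   [poisson_mass]. *)
set e := _ + _ => /(_ (\1_U) m.+1) H.
have {}H : \sum_(i < m.+1) \1_U i * binomial_pmf m d i <=
    \sum_(i < m.+1) \1_U i * poisson_mass a i + e.
  by apply: H => i; rewrite indicE lern1 leq_b1 ler0n.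
rewrite (@binomial_probE _ m d d0 d1) (_ : (\sum_(_ < _) _)%E =
    (\sum_(i < m.+1) \1_U i * binomial_pmf m d i)%:E); last first.
  rewrite -sumEFin; apply: eq_bigr => i _.
  by rewrite /binomial_pmf diracE indicE -EFinM mulrC.
apply: (@le_trans _ _ (\sum_(i < m.+1) \1_U i * poisson_mass a i + e)%:E).
  by rewrite lee_fin.
rewrite EFinD leeD2r// /poisson_prob a0 esum_mkcond.
have pmfE i : (if i \in U then (poisson_pmf a i)%:E else 0%E) =
    (\1_U i * poisson_mass a i)%:E.
  by rewrite indicE /poisson_pmf a0; case: ifP => _; rewrite ?mul1r ?mul0r.
rewrite (eq_esum (fun i _ => pmfE i)) -nneseries_esumT; last first.
  by move=> i; rewrite lee_fin mulr_ge0// poisson_mass_ge0// ltW.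
rewrite -sumEFin -(big_mkord xpredT (fun i => (\1_U i * poisson_mass a i)%:E)).
apply: nneseries_lim_ge => i _ _.
by rewrite lee_fin mulr_ge0// poisson_mass_ge0// ltW.
Qed.

Section ProbabilityDistance.
Context {R : realType}.
Local Open Scope ereal_scope.

Lemma integral_leD d (T : measurableType d) (mu : probability T R)
    (f g : T -> \bar R) (e : R) :
    measurable_fun setT f -> measurable_fun setT g ->
    (forall x, 0 <= f x) -> (forall x, 0 <= g x) -> (0 <= e)%R ->
    (forall x, f x <= g x + e%:E) ->
  \int[mu]_x f x <= \int[mu]_x g x + e%:E.
Proof.
move=> mf mg f0 g0 e0 fg.
apply: (@le_trans _ _ (\int[mu]_x (g x + e%:E))).
  by apply: ge0_le_integral => //; exact: emeasurable_funD.
by rewrite ge0_integralD//= integral_cst//= probability_setT mule1.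
Qed.

Lemma product_measure_le_add d1 d2 (T1 : measurableType d1)
    (T2 : measurableType d2) (mu mu' : probability T1 R)
    (nu nu' : probability T2 R) (e1 e2 : R) : (0 <= e1)%R -> (0 <= e2)%R ->
    (forall U, measurable U -> mu U <= mu' U + e1%:E) ->
    (forall U, measurable U -> nu U <= nu' U + e2%:E) ->
  forall C, measurable C -> (mu \x nu) C <= (mu' \x nu') C + (e1 + e2)%:E.
Proof.
move=> e10 e20 mule nule C mC.
apply: (@le_trans _ _ ((mu \x nu') C + e2%:E)).
  apply: integral_leD => //=; try exact: measurable_fun_xsection.
  by move=> x; apply: nule; exact: measurable_xsection.
rewrite EFinD addeA leeD2r//.
(* Replacing the first factor requires integrating its sections against [nu'], that is, the other
   order of integration. *)
have swap (m : probability T1 R) : (m \x nu') C = (m \x^ nu') C.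
  by apply: product_measure_unique => // A B mA mB; exact: product_measure2E.
rewrite !swap; apply: integral_leD => //=; try exact: measurable_fun_ysection.
by move=> x; apply: mule; exact: measurable_ysection.
Qed.

(** The bound at the complement of [U] is the reverse inequality at [U], both total masses being
    1. *)
Lemma probability_dist_le d (T : measurableType d) (mu nu : probability T R)
    (e : R) : (forall U, measurable U -> mu U <= nu U + e%:E) ->
  forall U, measurable U -> (`|fine (mu U) - fine (nu U)| <= e)%R.
Proof.
move=> mn.
have le U : measurable U -> (fine (mu U) <= fine (nu U) + e)%R.
  move=> mU; have := mn U mU.
  by rewrite -[mu U]fineK ?fin_num_measure// -[nu U]fineK ?fin_num_measure.
move=> U mU; have := le _ (measurableC mU).
rewrite !probability_setC// !fineB ?fin_num_measure//=.
by have := le _ mU; rewrite ler_norml; lra.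
Qed.

End ProbabilityDistance.

(** * Stability of the hockey-stick divergence and the explicit error *)

Lemma hs_divergence_le_add d (T : measurableType d) (R : realType)
    (Q P Q' P' : probability T R) (eps eQ eP : R) :
    (forall U, measurable U -> `|fine (Q U) - fine (Q' U)| <= eQ) ->
    (forall U, measurable U -> `|fine (P U) - fine (P' U)| <= eP) ->
  hs_divergence Q P eps <= hs_divergence Q' P' eps + (eQ + expR eps * eP).
Proof.
move=> hQ hP; apply: ge_sup; first exact: (has_sup_hs_divergence Q P eps).1.
move=> _ [A mA <-].
have : fine (Q' A) - expR eps * fine (P' A) <= hs_divergence Q' P' eps.
  apply: ub_le_sup; first exact: (has_sup_hs_divergence Q' P' eps).2.
  by exists A.
have := hQ _ mA; rewrite ler_norml => /andP[_ hQA].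
have := hP _ mA; rewrite ler_norml => /andP[hPA _].
have := ler_wpM2l (expR_ge0 eps) hPA.
by lra.
Qed.

Lemma hs_divergence_dist d (T : measurableType d) (R : realType)
    (Q P Q' P' : probability T R) (eps eQ eP : R) :
    (forall U, measurable U -> `|fine (Q U) - fine (Q' U)| <= eQ) ->
    (forall U, measurable U -> `|fine (P U) - fine (P' U)| <= eP) ->
  `|hs_divergence Q P eps - hs_divergence Q' P' eps| <= eQ + expR eps * eP.
Proof.
move=> hQ hP; have := hs_divergence_le_add eps hQ hP.
have hQ' U : measurable U -> `|fine (Q' U) - fine (Q U)| <= eQ.
  by rewrite distrC; exact: hQ.
have hP' U : measurable U -> `|fine (P' U) - fine (P U)| <= eP.
  by rewrite distrC; exact: hP.
by have := hs_divergence_le_add eps hQ' hP'; rewrite ler_norml; lra.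
Qed.

(** Total cost of making Poisson two binomials with [n - x] and [x] trials: the Le Cam terms add up
    to [n * d ^+ 2], and the rest corrects the rates to [a] and [b]. *)
Definition poisson_error (R : realType) (n x d a b : R) : R :=
  n * d ^+ 2 + `|(n - x) * d - a| + `|x * d - b|.

Lemma diff_law_binomial_poisson (R : realType) n k (d a b : R) :
    (k <= n)%N -> 0 <= d <= 1 -> 0 < a -> 0 < b ->
  forall U, measurable U ->
  `|fine (diff_law (binomial_prob (n - k) d) (binomial_prob k d) U) -
    fine (diff_law (poisson_prob a 0) (poisson_prob b 0) U)| <=
  poisson_error n%:R k%:R d a b.
Proof.
move=> kn d01 a0 b0; apply: probability_dist_le => U mU.
rewrite (_ : poisson_error _ _ _ _ _ =
    ((n - k)%:R * d ^+ 2 + `|(n - k)%:R * d - a|) +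
    (k%:R * d ^+ 2 + `|k%:R * d - b|)); last first.
  by rewrite /poisson_error -{1}(subnK kn) natrD natrB//; ring.
apply: product_measure_le_add.
- by rewrite addr_ge0// mulr_ge0// sqr_ge0.
- by rewrite addr_ge0// mulr_ge0// sqr_ge0.
- by move=> V _; exact: binomial_le_poisson.
- by move=> V _; exact: binomial_le_poisson.
- by rewrite -[X in measurable X]setTI; exact: measurable_diffz.
Qed.

Lemma hs_divergence_fin_lim (R : realType) n k (c p eps0 eps : R)
    (err := fun x => poisson_error n%:R x (flip_prob eps0)
      ((1 - p) / c ^+ 2) (p / c ^+ 2)) :
    0 < c -> 0 < p -> p < 1 -> (k < n)%N ->
  `|hs_divergence (Q_fin n k eps0) (P_fin n k eps0) eps -
    hs_divergence (Q_lim c p) (P_lim c p) eps| <=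
  err k.+1%:R + expR eps * err k%:R.
Proof.
move=> c0 p0 p1 kn; have d01 : 0 <= flip_prob eps0 <= 1.
  have e0 := expR_gt0 eps0; rewrite /flip_prob div1r invr_ge0 invf_le1; lra.
have a0 : 0 < (1 - p) / c ^+ 2 by rewrite divr_gt0 ?exprn_gt0 ?subr_gt0.
have b0 : 0 < p / c ^+ 2 by rewrite divr_gt0 ?exprn_gt0.
apply: hs_divergence_dist => U mU.
  (* Up to the shift, which is absorbed into the event, [Q_fin] is the difference law with [k.+1] in
     place of [k]; [k < n] keeps [k.+1 <= n]. *)
  rewrite /Q_fin -subnDA addn1.
  exact: (diff_law_binomial_poisson kn d01 a0 b0 (U := succz @^-1` U)).
exact: diff_law_binomial_poisson (ltnW kn) d01 a0 b0 _ mU.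
Qed.

Lemma poisson_error_le (R : realType) (y p x n : R) :
    0 < y -> 0 <= p <= 1 -> 0 < n -> `|x - p * n| <= 1 ->
  poisson_error n x (1 / (1 + y * n)) ((1 - p) / y) (p / y) <=
  (2 * y + 2) / (y ^+ 2 * n).
Proof.
move=> y0 /andP[p0 p1] n0 xpn; have yn0 : 0 < y * n by rewrite mulr_gt0.
have y_neq0 : y != 0 by rewrite gt_eqF.
have n_neq0 : n != 0 by rewrite gt_eqF.
have D_neq0 : 1 + y * n != 0 by rewrite gt_eqF//; lra.
have D0 : 0 < 1 + y * n by lra.
have yD0 : 0 < y * (1 + y * n) by rewrite mulr_gt0.
(* Over the common denominator [y * (1 + y * n)] the rate errors have numerators [- t - (1 - p)] and
   [t - p], whose absolute values sum to at most [2 * y + 1]. *)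
set t := y * (x - p * n).
have ty : `|t| <= y by rewrite normrM gtr0_norm// ler_piMr// ltW.
(* The first summand bounds the Le Cam term, the second one the two rate errors. *)
have -> : (2 * y + 2) / (y ^+ 2 * n) =
    n / (y * n) ^+ 2 + (2 * y + 1) / (y * (y * n)).
  by field; rewrite n_neq0.
rewrite /poisson_error -addrA lerD//.
  rewrite expr_div_n expr1n div1r ler_pM2l// lef_pV2 ?posrE ?exprn_gt0//.
  by rewrite lerXn2r ?nnegrE ?(ltW D0) ?(ltW yn0)// lerDr.
have -> : (n - x) * (1 / (1 + y * n)) - (1 - p) / y =
    (- t - (1 - p)) / (y * (1 + y * n)).
  by rewrite /t; field; rewrite ?y_neq0 ?D_neq0.
have -> : x * (1 / (1 + y * n)) - p / y = (t - p) / (y * (1 + y * n)).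
  by rewrite /t; field; rewrite ?y_neq0 ?D_neq0.
rewrite !normrM normfV (gtr0_norm yD0) -mulrDl.
apply: (@le_trans _ _ ((2 * y + 1) / (y * (1 + y * n)))).
  rewrite ler_pM2r ?invr_gt0//; have := ler_normB (- t) (1 - p).
  have := ler_normB t p; rewrite normrN (ger0_norm p0) (@ger0_norm _ (1 - p)).
    lra.
  by rewrite subr_ge0.
rewrite ler_pM2l; last lra.
rewrite lef_pV2 ?posrE//; last by rewrite mulr_gt0.
by rewrite ler_pM2l//; lra.
Qed.

(** * Vanishing of the error, then the limit and its rate *)

Lemma cvgr_invn (R : realType) : (n%:R^-1 : R) @[n --> \oo] --> (0 : R).
Proof.
apply/gtr0_cvgV0; last exact: cvgr_idn.
by near=> n; rewrite ltr0n; near: n; exists 1%N.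
Unshelve. all: by end_near. Qed.

Lemma cvg_poisson_error (R : realType) (x d : nat -> R) (p l : R) :
    (n%:R * d n @[n --> \oo] --> l) -> (x n / n%:R @[n --> \oo] --> p) ->
  poisson_error n%:R (x n) (d n) ((1 - p) * l) (p * l) @[n --> \oo] --> (0 : R).
Proof.
move=> dl xp.
have invn := @cvgr_invn R.
(* The error is rewritten in the convergent quantities [n%:R * d n] and [x n / n%:R], which is
   legitimate once [n] is nonzero. *)
pose f n := n%:R * d n * (n%:R * d n) * n%:R^-1 +
  `|(1 - x n / n%:R) * (n%:R * d n) - (1 - p) * l| +
  `|x n / n%:R * (n%:R * d n) - p * l|.
have fe : {near \oo, f =1
    fun n => poisson_error n%:R (x n) (d n) ((1 - p) * l) (p * l)}.
  near=> n; rewrite /f /poisson_error/=.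
  have n_neq0 : n%:R != 0 :> R.
    by rewrite pnatr_eq0 -lt0n; near: n; exists 1%N.
  by congr (_ + _ + _); [|congr Num.norm|congr Num.norm]; field.
apply: cvg_trans (near_eq_cvg fe) _.
have cvg_dist (u : nat -> R) a : u n @[n --> \oo] --> a ->
    `|u n - a| @[n --> \oo] --> (0 : R).
  by move=> ua; rewrite -(normr0 R) -(subrr a); apply: cvg_norm;
    apply: cvgB => //; exact: cvg_cst.
rewrite -[0](_ : l * l * 0 + 0 + 0 = 0); last by rewrite mulr0 !addr0.
apply: cvgD; [apply: cvgD|].
- by apply: cvgM invn; exact: cvgM.
- by apply: cvg_dist; apply: cvgM dl; apply: cvgB xp; exact: cvg_cst.
- by apply: cvg_dist; exact: cvgM.
Unshelve. all: by end_near. Qed.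

Theorem corollary4p4 (R : realType) (c p : R) (c_gt0 : 0 < c)
    (p_gt0 : 0 < p) (p_lt1 : p < 1) :
  (forall (eps0 : nat -> R) (k : nat -> nat),
      (\forall n \near \oo, 0 < eps0 n) ->
      (\forall n \near \oo, (k n < n)%N) ->
      ((k n)%:R / n%:R : R) @[n --> \oo] --> p ->
      (expR (eps0 n) / n%:R) @[n --> \oo] --> c ^+ 2 ->
    forall eps : R, 0 <= eps ->
      hs_divergence (Q_fin n (k n) (eps0 n)) (P_fin n (k n) (eps0 n)) eps
        @[n --> \oo] --> hs_divergence (Q_lim c p) (P_lim c p) eps)
  /\
  (forall (n k : nat) (eps0 : R),
      (0 < n)%N -> 0 < eps0 ->
      expR eps0 = c ^+ 2 * n%:R ->
      k%:Z = Num.floor (p * n%:R) ->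
    forall eps : R, 0 <= eps ->
      `|hs_divergence (Q_fin n k eps0) (P_fin n k eps0) eps
        - hs_divergence (Q_lim c p) (P_lim c p) eps|
      <= (1 + expR eps) * ((2 * c ^+ 2 + 3) / (c ^+ 4 * n%:R))).
Proof.
have y0 : 0 < c ^+ 2 by rewrite exprn_gt0.
split=> [eps0 k _ kn kp e0 eps _|n k eps0 n0 _ e0 kE eps _].
  have invn := @cvgr_invn R.
  have dl : n%:R * flip_prob (eps0 n) @[n --> \oo] --> (c ^+ 2)^-1.
    have fe : {near \oo, (fun n => (n%:R^-1 + expR (eps0 n) / n%:R)^-1) =1
        fun n => n%:R * flip_prob (eps0 n)}.
      near=> n; have n_gt0 : 0 < n%:R :> R.
        by rewrite ltr0n; near: n; exists 1%N.
      have E0 := expR_gt0 (eps0 n).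
      by rewrite /flip_prob; field; rewrite !gt_eqF//; lra.
    apply: cvg_trans (near_eq_cvg fe) _.
    apply: cvgV; first by rewrite gt_eqF.
    by rewrite -[c ^+ 2]add0r; exact: cvgD.
  (* The error for [Q_fin] is taken at [k.+1], which has the same limiting proportion. *)
  have kp1 : ((k n).+1%:R / n%:R : R) @[n --> \oo] --> p.
    rewrite -[p]addr0; under eq_fun do rewrite -natr1 mulrDl mul1r.
    exact: cvgD.
  apply/subr_cvg0; apply: norm_cvg0.
  have := cvgD (cvg_poisson_error dl kp1)
    (cvgMl_tmp (a := expR eps) (cvg_poisson_error dl kp)).
  rewrite mulr0 addr0 => /(_ _ _) err0.
  apply: (squeeze_cvgr _ (cvg_cst 0) err0).
  by near=> n; rewrite normr_ge0/= hs_divergence_fin_lim//; near: n.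
have n0' : 0 < n%:R :> R by rewrite ltr0n.
(* From [k <= p * n < k + 1], both [k] and [k + 1] lie within 1 of [p * n], as [poisson_error_le]
   requires; with [p < 1] also [k < n]. *)
have := floor_le (p * n%:R); have := floorD1_gt (p * n%:R).
rewrite -kE (_ : k%:Z + 1 = k.+1%:Z); last by rewrite -(addn1 k) PoszD.
rewrite -!pmulrn => pk kp.
have kn : (k < n)%N.
  by rewrite -(ltr_nat R) (le_lt_trans kp)// gtr_pMl.
apply: le_trans (hs_divergence_fin_lim _ _ c_gt0 p_gt0 p_lt1 kn) _.
rewrite /flip_prob e0 [leRHS]mulrDl [X in _ <= X + _]mul1r.
have p01 : 0 <= p <= 1 by rewrite !ltW.
(* The argument yields the numerator [2 * c ^+ 2 + 2], slightly better than the stated one. *)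
have cE : (2 * c ^+ 2 + 2) / ((c ^+ 2) ^+ 2 * n%:R) <=
    (2 * c ^+ 2 + 3) / (c ^+ 4 * n%:R).
  rewrite -exprM ler_pM2r ?invr_gt0 ?mulr_gt0 ?exprn_gt0//.
  by rewrite lerD2l ler_nat.
apply: lerD; last apply: (ler_wpM2l (expR_ge0 eps)).
- apply: le_trans (poisson_error_le y0 p01 n0' _) cE.
  by move: pk; rewrite ler_norml -natr1; lra.
- apply: le_trans (poisson_error_le y0 p01 n0' _) cE.
  by move: pk; rewrite ler_norml -natr1; lra.
Unshelve. all: by end_near. Qed.
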